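(* For every $f\in\mathcal{L}_2(1,1;\mathbb{R})$ and every $t\in\mathbb{R}$, $$|f'(t)|\le\sqrt{2\bigl(1-|f(t)|\bigr)}.$$ In particular, $$\sup_{f\in\mathcal{L}_2(1,1;\mathbb{R})}\|f'\|_\infty=\sqrt2,$$ and this bound is attained for $f=q$.
   Context: $\mathcal{L}_2(1,1;\mathbb{R})$ is the set of differentiable functions $f:\mathbb{R}\to\mathbb{R}$ with $f'$ absolutely continuous on every compact interval, such that $|f(t)|\le 1$ for all $t\in\mathbb{R}$ and $|f''(t)|\le1$ for almost every $t\in\mathbb{R}$ (equivalently, $|f|\le1$ and $f'$ is $1$-Lipschitz). $\|\cdot\|_\infty$ is the (essential) supremum norm on $\mathbb{R}$. The function $q:\mathbb{R}\to\mathbb{R}$ is the function of period $4\sqrt2$ such that $q(t)=1-t^2/2$ for $|t|\le\sqrt2$ and $q(t+2\sqrt2)=-q(t)$ for $|t|\le\sqrt2$. *)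

(* Defs.v *)
From HB Require Import structures.
From mathcomp Require Import all_boot all_order all_algebra.
From mathcomp Require Import lra ring.
From mathcomp Require Import all_classical all_reals all_analysis.

Set Implicit Arguments.
Unset Strict Implicit.
Unset Printing Implicit Defensive.
Import Order.TTheory GRing.Theory Num.Theory.
Import numFieldNormedType.Exports.

Local Open Scope ring_scope.
Local Open Scope classical_set_scope.

(* The library's `<< is absolute continuity of measures; this is the classical
   epsilon-delta notion for a real function on the compact interval [a, b].
   Degenerate intervals (l i = r i) are allowed; they contribute 0 to both
   sums. *)
Definition abs_continuous_on (R : realType) (a b : R) (g : R -> R) : Prop :=
  forall e : R, 0 < e -> exists2 d : R, 0 < d &
    forall (n : nat) (l r : 'I_n -> R),
      (forall i, a <= l i /\ l i <= r i /\ r i <= b) ->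
      trivIset [set: 'I_n] (fun i => `]l i, r i[%classic) ->
      \sum_(i < n) (r i - l i) < d ->
      \sum_(i < n) `|g (r i) - g (l i)| < e.

(* The class L_2(1, 1; R).  Since [f^`(2) t] is a default value where f' is not
   derivable, the almost-everywhere bound also asserts the existence of f''. *)
Definition L2_11 (R : realType) : set (R -> R) :=
  [set f : R -> R | [/\ forall t, derivable f t 1,
               forall a b, a <= b -> abs_continuous_on a b f^`(),
               forall t, `|f t| <= 1
             & {ae (@lebesgue_measure R), forall t,
                 derivable f^`() t 1 /\ `|f^`(2) t| <= 1} ]].

Definition sup_norm (R : realType) (g : R -> R) : \bar R :=
  ('N[@lebesgue_measure R]_+oo [EFin \o g])%E.

Definition is_q (R : realType) (g : R -> R) : Prop :=
  [/\ periodic g (4 * Num.sqrt 2),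
      forall t, `|t| <= Num.sqrt 2 -> g t = 1 - t ^+ 2 / 2
    & forall t, `|t| <= Num.sqrt 2 -> g (t + 2 * Num.sqrt 2) = - g t].

(* [u] is the representative of t modulo 4 sqrt 2 in [- sqrt 2, 3 sqrt 2[. *)
Definition q (R : realType) (t : R) : R :=
  let s := Num.sqrt 2 in
  let u := t - (Num.floor ((t + s) / (4 * s)))%:~R * (4 * s) in
  if u <= s then 1 - u ^+ 2 / 2 else - (1 - (u - 2 * s) ^+ 2 / 2).

Lemma q_floor (R : realType) (t : R) (n : int) :
  - Num.sqrt 2 <= t - n%:~R * (4 * Num.sqrt 2) < 3 * Num.sqrt 2 ->
  Num.floor ((t + Num.sqrt 2) / (4 * Num.sqrt 2)) = n.
Proof.
have s0 : 0 < Num.sqrt 2 :> R by rewrite sqrtr_gt0.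
move=> /andP[h1 h2]; apply: floor_def.
rewrite ler_pdivlMr ?ltr_pdivrMr ?mulr_gt0// intrD.
by apply/andP; split; nra.
Qed.

Lemma q_dom (R : realType) (t : R) : exists n : int,
  - Num.sqrt 2 <= t - n%:~R * (4 * Num.sqrt 2) < 3 * Num.sqrt 2.
Proof.
have s0 : 0 < Num.sqrt 2 :> R by rewrite sqrtr_gt0.
exists (Num.floor ((t + Num.sqrt 2) / (4 * Num.sqrt 2))).
have := floor_itv ((t + Num.sqrt 2) / (4 * Num.sqrt 2)).
rewrite ler_pdivlMr ?ltr_pdivrMr ?mulr_gt0// intrD => /andP[h1 h2].
by apply/andP; split; nra.
Qed.

Lemma q_is_q (R : realType) : is_q (@q R).
Proof.
have s0 : 0 < Num.sqrt 2 :> R by rewrite sqrtr_gt0.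
have s2 : Num.sqrt 2 ^+ 2 = 2 :> R by rewrite sqr_sqrtr.
split=> t.
- have [n hn] := q_dom t.
  have E : t + 4 * Num.sqrt 2 - (n + 1)%:~R * (4 * Num.sqrt 2) =
           t - n%:~R * (4 * Num.sqrt 2) by rewrite intrD; lra.
  by rewrite /q (q_floor hn) (@q_floor _ _ (n + 1)) E.
- rewrite ler_norml => /andP[h1 h2]; rewrite /q (@q_floor _ _ 0) mul0r subr0.
    by rewrite h2.
  by apply/andP; split; lra.
- rewrite ler_norml => /andP[h1 h2].
  have -> : q t = 1 - t ^+ 2 / 2.
    rewrite /q (@q_floor _ _ 0) mul0r subr0 ?h2//.
    by apply/andP; split; lra.
  have [ts|ts] := ltP t (Num.sqrt 2).
    rewrite /q (@q_floor _ _ 0) mul0r subr0; last by apply/andP; split; lra.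
    case: ifPn => [h|_]; last by rewrite addrK.
    have -> : t = - Num.sqrt 2 by lra.
    have -> : - Num.sqrt 2 + 2 * Num.sqrt 2 = Num.sqrt 2 :> R by lra.
    by rewrite sqrrN s2; lra.
  have -> : t = Num.sqrt 2 by lra.
  rewrite /q (@q_floor _ _ 1); last by apply/andP; split; lra.
  have -> : Num.sqrt 2 + 2 * Num.sqrt 2 - 1%:~R * (4 * Num.sqrt 2) =
            - Num.sqrt 2 :> R by lra.
  by rewrite ifT ?sqrrN ?s2; lra.
Qed.

Lemma is_qE (R : realType) (g : R -> R) : is_q g <-> g = @q R.
Proof.
have s0 : 0 < Num.sqrt 2 :> R by rewrite sqrtr_gt0.
split=> [|->]; last exact: q_is_q.
have [qp q1 q2] := @q_is_q R; move=> [gp g1 g2].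
have perZ h (n : int) u : periodic h (4 * Num.sqrt 2) ->
    h (u + n%:~R * (4 * Num.sqrt 2)) = h u :> R.
  move=> hp; have hn m v : h (v + m%:R * (4 * Num.sqrt 2)) = h v :> R.
    by rewrite mulr_natl periodicn.
  case: n => m; first exact: hn.
  by rewrite NegzE intrN mulNr -[LHS](hn m.+1) subrK.
apply/funext => t; have [n /andP[h1 h2]] := q_dom t.
rewrite -[t](subrK (n%:~R * (4 * Num.sqrt 2))) !perZ//.
set u := t - _ in h1 h2 *.
have [us|us] := leP u (Num.sqrt 2).
  by rewrite g1 ?q1// ler_norml h1.
have hu : `|u - 2 * Num.sqrt 2| <= Num.sqrt 2.
  by rewrite ler_norml; apply/andP; split; lra.
by rewrite -[u](subrK (2 * Num.sqrt 2)) g2// q2// g1// q1.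
Qed.

(* Main.v *)
(** Since f' is absolutely continuous with |f''| <= 1 almost everywhere, f' is
    1-Lipschitz.  Indeed, cover the exceptional null set by an open set U of
    small measure.  Cousin's lemma cuts [a, b] into pieces that either satisfy
    |f'(z) - f'(x)| <= (1 + e) (z - x), when tagged by a good point, or have
    their interior in U; the latter have small total length and hence contribute
    little by absolute continuity.

    Taylor's bound then gives, with p = f'(t), f(t + p) >= f(t) + p^2 / 2 and
    f(t - p) <= f(t) - p^2 / 2, and |f| <= 1 yields p^2 <= 2 (1 - |f(t)|).

    The derivative of q is a triangle wave: around the centers n 2 sqrt 2, q is
    (-1)^n times the parabola 1 - u^2 / 2.  It tends to sqrt 2 in absolute value
    at sqrt 2, so the bound sqrt 2 is its essential supremum. *)
Require Import Defs.
From mathcomp Require Import all_boot all_order all_algebra.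
From mathcomp Require Import lra ring.
From mathcomp Require Import all_classical all_reals all_analysis.
From mathcomp Require Import measurable_realfun ess_sup_inf.
Set Implicit Arguments.
Unset Strict Implicit.
Unset Printing Implicit Defensive.
Import Order.TTheory GRing.Theory Num.Theory.
Import numFieldNormedType.Exports.
Local Open Scope ring_scope.
Local Open Scope classical_set_scope.

(** * Cousin's lemma and the Lipschitz bound for absolutely continuous functions *)

(** The supremum of the [y] with [P a y] is itself reached and cannot lie below [b], since the local
    hypothesis at the supremum carries [P] across it. *)
Lemma cousin (R : realType) (P : R -> R -> Prop) (a b : R) :
  a <= b ->
  (forall x y z, x <= y -> y <= z -> P x y -> P y z -> P x z) ->
  (forall x, exists2 d : R, 0 < d &
     forall u v : R, x - d < u <= x -> x <= v < x + d -> P u v) ->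
  P a b.
Proof.
move=> ab Padd Ploc.
pose S := [set y | a <= y <= b /\ P a y].
have Sa : S a.
  split; first by rewrite lexx.
  by have [d d0 Pd] := Ploc a; apply: Pd; apply/andP; split; lra.
have hS : has_sup S by split; [exists a|exists b => y -[/andP[_ yb] _]].
have [d d0 Pd] := Ploc (sup S).
have [y [/andP[ay yb] Pay] cy] := sup_adherent d0 hS.
have yc : y <= sup S.
  by apply: (ub_le_sup hS.2); split=> //; rewrite ay yb.
have cb : sup S <= b by apply: ge_sup hS.1 _ => z [/andP[_ ->]].
(* Unless [v] is [b], it lies strictly beyond the supremum; both [y] and [v] are within [d] of
   it. *)
pose v := Num.min b (sup S + d / 2).
have cv : sup S <= v by rewrite le_min cb; lra.
have vb : v <= b by rewrite ge_min lexx.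
have vd : v < sup S + d by rewrite gt_min; apply/orP; right; lra.
have Pav : P a v.
  apply: Padd Pay _ => //; first exact: le_trans cv.
  by apply: Pd; rewrite ?cy ?yc ?cv ?vd.
have vS : v <= sup S.
  by apply: (ub_le_sup hS.2); split=> //; rewrite vb andbT; lra.
have vE : v = b.
  move: vS; rewrite /v; case: (leP b) => // h1 h2; lra.
by rewrite -vE.
Qed.

Lemma derivable_near_lipschitz (R : realType) (g : R -> R) (x k : R) :
  derivable g x 1 -> `|g^`() x| < k ->
  exists2 d : R, 0 < d & forall y : R, `|y - x| < d -> `|g y - g x| <= k * `|y - x|.
Proof.
move=> dg gk.
have : (fun h : R => `|h^-1 *: (g (h + x) - g x)|) @ 0^' --> `|g^`() x|.
  apply: cvg_norm; rewrite derive1E.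
  have -> : (fun h : R => h^-1 *: (g (h + x) - g x)) =
            (fun h : R => h^-1 *: ((g \o shift x) (h *: 1) - g x)).
    by apply/funext => h /=; rewrite /GRing.scale/= mulr1.
  exact: dg.
move=> /cvgr_lt/(_ k gk)/nbhs_ballP[d /= d0 hd].
exists d => // y yd.
have [->|yx] := eqVneq y x; first by rewrite !subrr normr0 mulr0.
have yx0 : y - x != 0 by rewrite subr_eq0.
have := hd (y - x); rewrite /ball/= sub0r normrN => /(_ yd yx0).
rewrite subrK /GRing.scale/= normrM normfV mulrC ltr_pdivrMr ?normr_gt0//.
exact: ltW.
Qed.

Lemma measure_disjoint_itv (R : realType) (U : set R) n (l r : 'I_n -> R) :
  open U -> (forall i, l i <= r i) -> (forall i, `]l i, r i[ `<=` U) ->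
  trivIset [set: 'I_n] (fun i => `]l i, r i[%classic) ->
  ((\sum_(i < n) (r i - l i))%:E <= lebesgue_measure U)%E.
Proof.
move=> oU lr sU tI.
have -> : (\sum_(i < n) (r i - l i))%:E =
    lebesgue_measure (\big[setU/set0]_(i < n) `]l i, r i[%classic).
  rewrite measure_bigsetU_ord//= -sumEFin; apply: eq_bigr => i _.
  rewrite lebesgue_measure_itv/= lte_fin EFinB.
  by have := lr i; rewrite le_eqVlt => /orP[/eqP ->|->//]; rewrite ltxx subee.
apply: le_measure; rewrite ?inE; [exact: bigsetU_measurable|exact: open_measurable|].
rewrite -bigcup_seq => x [i _]; exact: sU.
Qed.

(** The predicate fed to [cousin]. The intervals inside [U] are kept as a family because absolute
    continuity has to be applied once, to all of them together. *)
Definition itv_variation_bound (R : realType) (U : set R) (k : R) (g : R -> R)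
    (x z : R) :=
  exists n (l r : 'I_n -> R),
    [/\ forall i, x <= l i /\ l i <= r i /\ r i <= z,
        trivIset [set: 'I_n] (fun i => `]l i, r i[%classic),
        forall i, `]l i, r i[ `<=` U
      & `|g z - g x| <= k * (z - x) + \sum_(i < n) `|g (r i) - g (l i)| ].

(** The two families are concatenated. They stay disjoint because the open intervals of the first
    lie left of [y] and those of the second right of [y]. *)
Lemma itv_variation_bound_trans (R : realType) (U : set R) (k : R) (g : R -> R)
    (x y z : R) : x <= y -> y <= z ->
  itv_variation_bound U k g x y -> itv_variation_bound U k g y z ->
  itv_variation_bound U k g x z.
Proof.
move=> xy yz [n1 [l1 [r1 [h1 t1 u1 b1]]]] [n2 [l2 [r2 [h2 t2 u2 b2]]]].
pose cat (f1 : 'I_n1 -> R) (f2 : 'I_n2 -> R) (i : 'I_(n1 + n2)) :=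
  match fintype.split i with inl j => f1 j | inr j => f2 j end.
have catl f1 f2 j : cat f1 f2 (lshift n2 j) = f1 j.
  by rewrite /cat (unsplitK (inl j)).
have catr f1 f2 j : cat f1 f2 (rshift n1 j) = f2 j.
  by rewrite /cat (unsplitK (inr j)).
exists (n1 + n2)%N, (cat l1 l2), (cat r1 r2); split.
- move=> i; rewrite /cat; case: (fintype.split i) => j.
    by have [? [? ?]] := h1 j; repeat split => //; lra.
  by have [? [? ?]] := h2 j; repeat split => //; lra.
- move=> i j _ _ [w []] /=; rewrite !in_itv/= => /andP[+ +] /andP[].
  case: (split_ordP i) => i' ->; case: (split_ordP j) => j' ->;
    rewrite ?catl ?catr => wi1 wi2 wj1 wj2.
  + congr lshift; apply: t1 => //; exists w; split; rewrite /= in_itv/=; exact/andP.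
  + have [_ [_ ?]] := h1 i'; have [? _] := h2 j'; exfalso; lra.
  + have [_ [_ ?]] := h1 j'; have [? _] := h2 i'; exfalso; lra.
  + congr rshift; apply: t2 => //; exists w; split; rewrite /= in_itv/=; exact/andP.
- by move=> i; rewrite /cat; case: (fintype.split i) => j.
- rewrite big_split_ord/=; under eq_bigr do rewrite !catl.
  under [X in _ + (_ + X)]eq_bigr do rewrite !catr.
  have := ler_normD (g z - g y) (g y - g x); rewrite addrA subrK; lra.
Qed.

Lemma itv_variation_bound_steep (R : realType) (U : set R) (k : R) (g : R -> R)
    (x z : R) : 0 <= k -> x <= z -> `]x, z[ `<=` U -> itv_variation_bound U k g x z.
Proof.
move=> k0 xz sU; exists 1%N, (fun=> x), (fun=> z); split => //.
- by move=> i j _ _ _; rewrite !ord1.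
- by rewrite big_ord1 lerDr mulr_ge0// subr_ge0.
Qed.

Lemma itv_variation_bound_flat (R : realType) (U : set R) (k : R) (g : R -> R)
    (x z : R) : `|g z - g x| <= k * (z - x) -> itv_variation_bound U k g x z.
Proof.
move=> h; exists 0%N, (fun=> 0), (fun=> 0); split => //.
- by case.
- by case.
- by case.
- by rewrite big_ord0 addr0.
Qed.

Lemma abs_continuous_lipschitz (R : realType) (g : R -> R) (k a b : R) :
  0 <= k -> a <= b -> abs_continuous_on a b g ->
  {ae (@lebesgue_measure R), forall t, derivable g t 1 /\ `|g^`() t| <= k} ->
  `|g b - g a| <= k * (b - a).
Proof.
move=> k0 ab ACg [N [mN N0 sN]].
apply/ler_addgt0Pr => e e0.
(* The excess slope costs [e1 * (b - a)] and the variation inside [U] less than [e1], which adds up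
   to less than [e]. *)
pose e1 := e / (b - a + 1).
have e10 : 0 < e1 by rewrite divr_gt0//; lra.
have [d d0 ACd] := ACg _ e10.
have [|U [oU NU Ud]] := lebesgue_regularity_outer mN _ d0.
  by rewrite [X in (X < _)%E]N0.
(* Outer regularity bounds the measure of [U] minus [N]; adding the null set [N] back changes
   nothing. *)
have {}Ud : (lebesgue_measure U < d%:E)%E.
  have mU : measurable U by exact: open_measurable.
  rewrite -(setDUK NU) [X in (X < _)%E]measureU ?setDIK//; last exact: measurableD.
  by rewrite [X in (X + _ < _)%E]N0 add0e.
suff [n [l [r [h t u bd]]]] : itv_variation_bound U (k + e1) g a b.
  have sd : \sum_(i < n) (r i - l i) < d.
    rewrite -lte_fin; apply: le_lt_trans Ud.
    by apply: measure_disjoint_itv => // i; have [_ []] := h i.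
  have := ACd n l r h t sd; move: bd; set S := \sum_(i < n) _.
  have : e1 * (b - a + 1) = e by rewrite divfK//; lra.
  lra.
apply: cousin => // [x y z|x]; first exact: itv_variation_bound_trans.
have [Nx|Nx] := pselect (N x).
  have /nbhs_ballP[d1 /= d10 hd1] : nbhs x U by apply: open_nbhs_nbhs; split=> //; exact: NU.
  exists d1 => // u v /andP[h1 h2] /andP[h3 h4].
  apply: itv_variation_bound_steep; [lra|lra|].
  move=> w /=; rewrite in_itv/= => /andP[? ?]; apply: hd1.
  by rewrite /ball/= ltr_distlC; apply/andP; split; lra.
have [dg gk] : derivable g x 1 /\ `|g^`() x| <= k.
  by apply: contrapT => H; apply: Nx; apply: sN.
have [|d1 d10 hd1] := @derivable_near_lipschitz _ g x (k + e1) dg; first lra.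
exists d1 => // u v /andP[h1 h2] /andP[h3 h4].
apply: itv_variation_bound_flat.
(* The increments on both sides of the tag [x] are bounded separately, then added. *)
have := hd1 v; rewrite ger0_norm ?subr_ge0// => /(_ ltac:(lra)) hv.
have := hd1 u; rewrite ler0_norm ?subr_le0// => /(_ ltac:(lra)) hu.
have := ler_normB (g v - g x) (g u - g x); rewrite opprB addrA subrK.
lra.
Qed.

(** * Taylor's bound and the pointwise inequality *)

Definition nonexpansive (R : realType) (g : R -> R) :=
  forall x y, `|g x - g y| <= `|x - y|.

(** The mean value theorem is applied to the Taylor remainder minus [e] times its claimed bound,
    with [e] equal to 1 or -1; the Lipschitz condition then fixes the sign of the derivative. Moving
    along [t + x * h] with [x] in [0, 1] treats both signs of [h] at once. *)
Lemma taylor_nonexpansive (R : realType) (f g : R -> R) (t h : R) :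
  (forall x : R, is_derive x 1 f (g x)) ->
  nonexpansive g ->
  `|f (t + h) - f t - g t * h| <= h ^+ 2 / 2.
Proof.
move=> df lip.
have mvt (e : R) : exists2 c, 0 <= c <= 1 &
    f (t + h) - f t - g t * h - e * (h ^+ 2 / 2) =
    h * (g (t + c * h) - g t) - e * (h ^+ 2 * c).
  pose phi (x : R) := f (t + x * h) - g t * h * x - e * (h ^+ 2 / 2) * x ^+ 2.
  pose dphi (x : R) := h * (g (t + x * h) - g t) - e * (h ^+ 2 * x).
  have dphiE (x : R) : is_derive x 1 phi (dphi x).
    rewrite /phi /dphi; apply: is_derive_eq.
    by rewrite /GRing.scale/=; field.
  have [|c] := @MVT_segment R phi dphi 0 1 ler01 (fun x _ => dphiE x).
    by apply: continuous_subspaceT => x; apply/differentiable_continuous/derivable1_diffP.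
  rewrite in_itv/= => c01; rewrite /phi /dphi => E; exists c => //.
  by rewrite mul0r !mul1r !addr0 expr0n/= !mulr0 !mulr1 expr1n mulr1 subr0 in E; lra.
have cup c : 0 <= c <= 1 ->
    `|h * (g (t + c * h) - g t)| <= h ^+ 2 * c.
  move=> /andP[c0 _]; rewrite normrM -[h ^+ 2]real_normK ?num_real// expr2 -mulrA.
  rewrite ler_wpM2l// (le_trans (lip _ _))// addrAC subrr add0r normrM ger0_norm//.
  by rewrite mulrC.
rewrite ler_norml; apply/andP; split.
  have [c c01 E] := mvt (-1); have := cup c c01; rewrite ler_norml => /andP[]; lra.
have [c c01 E] := mvt 1; have := cup c c01; rewrite ler_norml => /andP[]; lra.
Qed.

Lemma derive1_bound (R : realType) (f : R -> R) (t : R) :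
  (forall x : R, derivable f x 1) ->
  nonexpansive f^`() ->
  (forall x : R, `|f x| <= 1) ->
  `|f^`() t| <= Num.sqrt (2 * (1 - `|f t|)).
Proof.
move=> df lip f1; set p : R := f^`() t.
have dfg (x : R) : is_derive x 1 f (f^`() x) by rewrite derive1E; apply: derivableP.
(* The step [p] maximises the guaranteed gain [p * h - h ^+ 2 / 2], and [- p] the guaranteed
   loss. *)
have := taylor_nonexpansive t p dfg lip; rewrite ler_norml => /andP[h1 _].
have := taylor_nonexpansive t (- p) dfg lip; rewrite ler_norml => /andP[_ h2].
have := f1 (t + p); rewrite ler_norml => /andP[_ h3].
have := f1 (t + - p); rewrite ler_norml => /andP[h4 _].
rewrite -sqrtr_sqr ler_wsqrtr// mulrBr mulr1.
rewrite -/p in h1 h2; rewrite sqrrN in h2.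
by case: (ger0P (f t)) => _; lra.
Qed.

Lemma L2_11_nonexpansive (R : realType) (f : R -> R) : L2_11 f ->
  nonexpansive f^`().
Proof.
move=> [_ ac _ ae2].
set g := f^`() in ac ae2 *.
have H x y : x <= y -> `|g y - g x| <= y - x.
  move=> xy; rewrite -[leRHS]mul1r.
  apply: abs_continuous_lipschitz => //; exact: ac.
move=> x y; have [xy|/ltW yx] := leP x y; last exact: le_trans (H _ _ yx) (ler_norm _).
by rewrite distrC [leRHS]distrC (le_trans (H _ _ xy)) ?ler_norm.
Qed.

(** * Regularity of the extremal function q *)

Lemma nonexpansive_abs_continuous (R : realType) (g : R -> R) (a b : R) :
  nonexpansive g -> abs_continuous_on a b g.
Proof.
move=> lip e e0; exists e => // n l r h _; apply: le_lt_trans.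
apply: ler_sum => i _; apply: le_trans (lip _ _) _.
by have [_ [? _]] := h i; rewrite ger0_norm ?subr_ge0.
Qed.

(** The difference quotient is within [|h| / 2] of [a]. A two-sided quadratic estimate avoids
    one-sided limits where two parabolas meet. *)
Lemma is_derive_quadratic (R : realType) (f : R -> R) (x a d : R) : 0 < d ->
  (forall y : R, `|y - x| < d -> `|f y - f x - a * (y - x)| <= (y - x) ^+ 2 / 2) ->
  is_derive x 1 f a.
Proof.
move=> d0 hf.
have cv : h^-1 *: ((f \o shift x) (h *: 1) - f x) @[h --> 0^'] --> a.
  apply/cvgrPdist_le => e e0; near=> h.
  have h0 : h != 0 by near: h; exact: nbhs_dnbhs_neq.
  rewrite /GRing.scale/= mulr1.
  have hd : `|h| < d by near: h; apply: dnbhs0_lt.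
  have he : `|h| <= e by near: h; apply: dnbhs0_le.
  have := hf (h + x); rewrite addrK => /(_ hd) hh.
  have -> : a - h^-1 * (f (h + x) - f x) = - (h^-1 * (f (h + x) - f x - a * h)).
    by field.
  rewrite normrN normrM normfV mulrC ler_pdivrMr ?normr_gt0// (le_trans hh)//.
  rewrite -[h ^+ 2]real_normK ?num_real//; have := normr_ge0 h; nra.
apply: DeriveDef; first by apply/cvg_ex; exists a.
exact/cvg_lim.
Unshelve. all: by end_near. Qed.

Lemma q_shift (R : realType) (t : R) (n : int) :
  q (t + n%:~R * (4 * Num.sqrt 2)) = q t.
Proof.
have [m /andP[h1 h2]] := q_dom t.
have E : t + n%:~R * (4 * Num.sqrt 2) - (m + n)%:~R * (4 * Num.sqrt 2) =
         t - m%:~R * (4 * Num.sqrt 2) by rewrite intrD; ring.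
by rewrite /q (@q_floor _ t m) ?(@q_floor _ _ (m + n)) ?E ?h1.
Qed.

(** Extends the antiperiodicity of [is_q] to all reals: [t] is reduced modulo the period, and on the
    second half of the period the rule is used backwards, two half shifts making a full one. *)
Lemma q_half_shift (R : realType) (t : R) : q (t + 2 * Num.sqrt 2) = - q t.
Proof.
have [_ _ q2] := @q_is_q R.
have [m /andP[h1 h2]] := q_dom t.
rewrite -(q_shift t (- m)) -(q_shift (t + _) (- m)) addrAC intrN mulNr.
set u := t - _ in h1 h2 *.
have [us|us] := leP u (Num.sqrt 2); first by rewrite q2// ler_norml h1.
have -> : u + 2 * Num.sqrt 2 = u - 2 * Num.sqrt 2 + 1%:~R * (4 * Num.sqrt 2) by ring.
rewrite q_shift -{2}[u](subrK (2 * Num.sqrt 2)) q2 ?opprK//.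
by rewrite ler_norml; apply/andP; split; lra.
Qed.

(* [e] is the sign (-1)^n, where [c = n 2 sqrt 2]. *)
Definition q_center (R : realType) (c e : R) :=
  (e = 1 \/ e = -1) /\ forall v, q v = e * q (v - c).

Lemma q_centerD (R : realType) (c e : R) :
  q_center c e -> q_center (c + 2 * Num.sqrt 2) (- e).
Proof.
move=> [e1 qc]; split; first by case: e1 => ->; [right|left; rewrite opprK].
move=> v; rewrite qc -[v - c](subrK (2 * Num.sqrt 2)) q_half_shift.
by rewrite mulrN mulNr opprD addrA.
Qed.

Lemma q_centerB (R : realType) (c e : R) :
  q_center c e -> q_center (c - 2 * Num.sqrt 2) (- e).
Proof.
move=> [e1 qc]; split; first by case: e1 => ->; [right|left; rewrite opprK].
move=> v; rewrite qc opprB addrA addrAC -[v - c + _]/((v - c) + 2 * Num.sqrt 2).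
by rewrite q_half_shift mulrNN.
Qed.

(** Reduces questions about [q] at [t] to a single parabola; since the right bound is strict, only
    the left end is a junction. *)
Lemma q_center_exists (R : realType) (t : R) : exists (n : int) (e : R),
  - Num.sqrt 2 <= t - n%:~R * (2 * Num.sqrt 2) < Num.sqrt 2 /\
  q_center (n%:~R * (2 * Num.sqrt 2)) e.
Proof.
have [m /andP[h1 h2]] := q_dom t.
have qm : q_center (m%:~R * (4 * Num.sqrt 2)) (1 : R).
  split; [by left|move=> v].
  by rewrite mul1r -{1}[v](subrK (m%:~R * (4 * Num.sqrt 2))) q_shift.
have E : (2 * m)%:~R * (2 * Num.sqrt 2) = m%:~R * (4 * Num.sqrt 2) :> R.
  by rewrite intrM; ring.
have [h|h] := ltP (t - m%:~R * (4 * Num.sqrt 2)) (Num.sqrt 2).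
  by exists (2 * m), 1; rewrite E h1 h.
exists (2 * m + 1), (- 1); rewrite intrD mulrDl E mul1r; split; last exact: q_centerD.
by apply/andP; split; lra.
Qed.

Lemma q_center_near (R : realType) (c e t : R) : q_center c e ->
  `|t - c| <= Num.sqrt 2 -> q t = e * (1 - (t - c) ^+ 2 / 2).
Proof. by move=> [_ qc] tc; have [_ q1 _] := @q_is_q R; rewrite qc q1. Qed.

Lemma is_derive_q (R : realType) (c e t : R) : q_center c e ->
  `|t - c| <= Num.sqrt 2 -> is_derive t 1 (@q R) (- e * (t - c)).
Proof.
have s0 : 0 < Num.sqrt 2 :> R by rewrite sqrtr_gt0.
have s2 : Num.sqrt 2 * Num.sqrt 2 = 2 :> R by rewrite -expr2 sqr_sqrtr.
(* With this radius, [v] lies on the parabola of [t] or on an adjacent one. *)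
move=> ce tc; apply: (@is_derive_quadratic _ _ _ _ (Num.sqrt 2)) => // v.
rewrite (q_center_near ce tc).
move: tc; rewrite ler_norml => /andP[t1 t2].
rewrite ltr_norml => /andP[v1 v2].
have e1 : `|e| = 1 by case: ce.1 => ->; rewrite ?normrN normr1.
have norme (a X B : R) : a = e * X -> - B <= X <= B -> `|a| <= B.
  by move=> ->; rewrite normrM e1 mul1r ler_norml.
have [vc1|vc1] := ltP (v - c) (- Num.sqrt 2).
  rewrite (q_center_near (q_centerB ce)); last first.
    by rewrite ler_norml; apply/andP; split; lra.
  apply: (norme _ (- (1 - (v - c + 2 * Num.sqrt 2) ^+ 2 / 2)
    - (1 - (t - c) ^+ 2 / 2) + (t - c) * (v - t))); first by ring.
  (* As the square of [Num.sqrt 2] is 2, this square and the product below are exactly the gaps to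
     the lower and upper bounds. The right-hand neighbour is the mirror image. *)
  have := sqr_ge0 (v - c + Num.sqrt 2).
  have : 0 <= (t - c + Num.sqrt 2) * ((t - c) - Num.sqrt 2 - 2 * (v - c)).
    by apply: mulr_ge0; lra.
  by move=> ? ?; apply/andP; split; nra.
have [vc2|vc2] := leP (v - c) (Num.sqrt 2).
  rewrite (q_center_near ce); last by rewrite ler_norml vc1.
  apply: (norme _ (- (v - t) ^+ 2 / 2)); first by field.
  by have := sqr_ge0 (v - t) => ?; apply/andP; split; lra.
rewrite (q_center_near (q_centerD ce)); last first.
  by rewrite ler_norml; apply/andP; split; lra.
apply: (norme _ (- (1 - (v - c - 2 * Num.sqrt 2) ^+ 2 / 2)
  - (1 - (t - c) ^+ 2 / 2) + (t - c) * (v - t))); first by ring.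
have := sqr_ge0 (v - c - Num.sqrt 2).
have : 0 <= (Num.sqrt 2 - (t - c)) * (2 * (v - c) - Num.sqrt 2 - (t - c)).
  by apply: mulr_ge0; lra.
by move=> ? ?; apply/andP; split; nra.
Qed.

Lemma derive1_qE (R : realType) (c e t : R) : q_center c e ->
  `|t - c| <= Num.sqrt 2 -> (@q R)^`() t = - e * (t - c).
Proof.
by move=> ce tc; rewrite derive1E; apply: derive_val; exact: is_derive_q ce tc.
Qed.

Lemma derivable_q (R : realType) (t : R) : derivable (@q R) t 1.
Proof.
have [n [e [/andP[h1 h2] ce]]] := q_center_exists t.
have [|dq _] := @is_derive_q _ _ _ t ce; first by rewrite ler_norml h1 ltW.
exact: dq.
Qed.

Lemma q_bounded (R : realType) (t : R) : `|q t| <= 1.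
Proof.
have [n [e [/andP[h1 h2] ce]]] := q_center_exists t.
have s2 : Num.sqrt 2 * Num.sqrt 2 = 2 :> R by rewrite -expr2 sqr_sqrtr.
have s0 : 0 < Num.sqrt 2 :> R by rewrite sqrtr_gt0.
rewrite (q_center_near ce); last by rewrite ler_norml h1 ltW.
set u := t - _ in h1 h2 *; rewrite ler_norml.
by case: ce.1 => ->; apply/andP; split; nra.
Qed.

Lemma derive1_q_bounded (R : realType) (t : R) : `|(@q R)^`() t| <= Num.sqrt 2.
Proof.
have [n [e [/andP[h1 h2] ce]]] := q_center_exists t.
rewrite (derive1_qE ce); last by rewrite ler_norml h1 ltW.
rewrite ler_norml.
by case: ce.1 => ->; apply/andP; split; lra.
Qed.

Lemma derive1_q_nonexpansive (R : realType) : nonexpansive (@q R)^`().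
Proof.
have H (x y : R) : x <= y -> `|((@q R)^`() x)%classic - ((@q R)^`() y)%classic| <= y - x.
  move=> xy; have [n [e [/andP[h1 h2] ce]]] := q_center_exists x.
  rewrite (derive1_qE ce); last by rewrite ler_norml h1 ltW.
  set c := n%:~R * _ in h1 h2 ce *; rewrite ler_norml.
  have [vc2|vc2] := leP (y - c) (Num.sqrt 2).
    rewrite (derive1_qE ce); last by rewrite ler_norml; apply/andP; split; lra.
    by case: ce.1 => ->; apply/andP; split; lra.
  have [vc3|vc3] := leP (y - c) (3 * Num.sqrt 2).
    rewrite (derive1_qE (q_centerD ce)); last by rewrite ler_norml; apply/andP; split; lra.
    by case: ce.1 => ->; apply/andP; split; lra.
  (* Here [y - x] exceeds [2 * Num.sqrt 2], so the uniform bound on the derivative suffices. *)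
  have := derive1_q_bounded y; rewrite ler_norml => /andP[? ?].
  by case: ce.1 => ->; apply/andP; split; lra.
move=> x y; have [xy|/ltW yx] := leP x y.
  by rewrite [leRHS]distrC (le_trans (H _ _ xy)) ?ler_norm.
by rewrite distrC (le_trans (H _ _ yx)) ?ler_norm.
Qed.

Lemma is_derive_derive1_q (R : realType) (c e t : R) : q_center c e ->
  `|t - c| < Num.sqrt 2 -> is_derive t 1 (@q R)^`() (- e).
Proof.
move=> ce tc; apply: (@is_derive_quadratic _ _ _ _ (Num.sqrt 2 - `|t - c|)).
  by rewrite subr_gt0.
move=> v vt; have vc : `|v - c| <= Num.sqrt 2.
  by have := ler_normD (v - t) (t - c); rewrite addrA subrK; lra.
rewrite (derive1_qE ce vc) (derive1_qE ce (ltW tc)).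
rewrite [X in `|X|](_ : _ = 0) ?normr0; last by ring.
by rewrite divr_ge0 ?sqr_ge0.
Qed.

Lemma q_L2_11 (R : realType) : L2_11 (@q R).
Proof.
split.
- exact: derivable_q.
- by move=> a b _; apply: nonexpansive_abs_continuous; exact: derive1_q_nonexpansive.
- exact: q_bounded.
(* The junctions of consecutive parabolas, where the slope of the triangle wave jumps. *)
- pose A := range (fun n : int => n%:~R * (2 * Num.sqrt 2) - Num.sqrt 2 : R).
  have cA : countable A by exact: card_le_trans (card_image_le _ _) (countableP _).
  exists A; split.
  + by apply: countable_measurable.
  + exact: countable_lebesgue_measure0.
  + move=> t /=; apply: contra_notP => At.
    have [n [e [/andP[h1 h2] ce]]] := q_center_exists t.
    move: h1; rewrite le_eqVlt => /orP[/eqP h1|h1].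
      by exfalso; apply: At; exists n => //; lra.
    have dt : is_derive t 1 (@q R)^`() (- e).
      by apply: (is_derive_derive1_q ce); rewrite ltr_norml h1.
    split; first by case: dt.
    rewrite derive1E derive_val.
    by case: ce.1 => ->; rewrite ?opprK ?normrN normr1.
Qed.

(** * The essential supremum norm and the sharp constant *)

Lemma sup_norm_le (R : realType) (g : R -> R) (c : R) :
  (forall t : R, `|g t| <= c) -> (sup_norm g <= c%:E)%E.
Proof.
(* The norm is 0 by definition on a space of measure zero; in that branch the bound at the point 0
   gives [0 <= c]. *)
move=> gc; rewrite /sup_norm unlock; case: ifPn => _.
  by apply/ess_supP; apply: nearW => t /=; rewrite lee_fin.
by rewrite lee_fin; exact: le_trans (normr_ge0 (g 0)) (gc 0).
Qed.

Lemma ae_sup_norm (R : realType) (g : R -> R) :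
  {ae (@lebesgue_measure R), forall t, (`|(g t)%:E| <= sup_norm g)%E}.
Proof.
rewrite /sup_norm unlock ifT; first exact: ess_sup_ge.
have : (0 < lebesgue_measure (`]-oo, +oo[%classic : set R))%E.
  by rewrite lebesgue_measure_itv/= ltry.
by rewrite set_itvNyy.
Qed.

(** An interval of positive length is not contained in a null set. This turns almost-everywhere
    bounds into bounds at points near a prescribed one. *)
Lemma ae_itv (R : realType) (P : R -> Prop) (a b : R) : a < b ->
  {ae (@lebesgue_measure R), forall t, P t} -> exists2 t, a < t < b & P t.
Proof.
move=> ab [N [mN N0 sN]]; apply: contrapT => H.
have : (lebesgue_measure `]a, b[%classic <= lebesgue_measure N)%E.
  apply: le_measure; rewrite ?inE// => t /=; rewrite in_itv/= => tab.
  by apply: sN => Pt; apply: H; exists t.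
by rewrite [X in (_ <= X)%E]N0 lebesgue_measure_itv/= lte_fin ab -EFinB lee_fin leNgt subr_gt0 ab.
Qed.

Lemma sup_norm_derive1_q (R : realType) : sup_norm (@q R)^`() = (Num.sqrt 2)%:E.
Proof.
have s0 : 0 < Num.sqrt 2 :> R by rewrite sqrtr_gt0.
apply/eqP; rewrite eq_le sup_norm_le/=; last exact: derive1_q_bounded.
apply/lee_addgt0Pr => e e0.
(* The maximum with 0 keeps [t] positive on the central parabola, where the derivative of [q] has
   absolute value [t], within [e] of [Num.sqrt 2]. *)
have [|t /andP[t1 t2] ht] := @ae_itv R _ (Num.max 0 (Num.sqrt 2 - e)) (Num.sqrt 2) _ (ae_sup_norm (@q R)^`()).
  by rewrite gt_max s0; lra.
move: t1; rewrite gt_max => /andP[t0 te].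
have c0 : q_center (0 : R) 1 by split; [left|move=> v; rewrite subr0 mul1r].
apply: le_trans (leeD2r e%:E ht).
rewrite (derive1_qE c0) subr0 ?mulN1r; last by rewrite gtr0_norm ?ltW.
by rewrite abse_EFin normrN gtr0_norm// -EFinD lee_fin; lra.
Qed.

Theorem proposition18 (R : realType) :
  [/\ forall f : R -> R, L2_11 f ->
        forall t : R, `|f^`() t| <= Num.sqrt (2 * (1 - `|f t|)),
      ereal_sup [set sup_norm f^`() | f in @L2_11 R] = (Num.sqrt 2)%:E,
      L2_11 (@q R)
    & sup_norm (@q R)^`() = (Num.sqrt 2)%:E].
Proof.
have bound (f : R -> R) : L2_11 f ->
    forall t : R, `|f^`() t| <= Num.sqrt (2 * (1 - `|f t|)).
  by move=> Lf t; apply: derive1_bound (L2_11_nonexpansive Lf) _; case: Lf.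
split=> //; [|exact: q_L2_11|exact: sup_norm_derive1_q].
apply/eqP; rewrite eq_le; apply/andP; split.
  apply: ge_ereal_sup => _ [f Lf <-]; apply: sup_norm_le => t.
  apply: le_trans (bound f Lf t) _; rewrite ler_wsqrtr//.
  by have := normr_ge0 (f t); lra.
rewrite -sup_norm_derive1_q; apply: ereal_sup_ubound.
by exists (@q R) => //; exact: q_L2_11.
Qed.
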